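(* Let $q=p^e>2$ with $p$ prime, let $r\ge2$, $m=2r$, $D=\{x\in\mathbb{F}_{q^m}:\mathrm{Tr}_{q^r/q}(x^{q^r+1})=0\}=\{d_1,\dots,d_n\}$ with $n=q^{r-1}(q^r-q+1)$, and let $\alpha$ be a generator of $\mathbb{F}_{q^m}^*$. Let $G_1$ be the $(m+1)\times n$ matrix whose first row is $(1,\dots,1)$, whose second row is $(\mathrm{Tr}_{q^m/q}(d_1),\dots,\mathrm{Tr}_{q^m/q}(d_n))$, whose third row is $(\mathrm{Tr}_{q^m/q}(\alpha d_1)+1,\dots,\mathrm{Tr}_{q^m/q}(\alpha d_n)+1)$, and whose $(i+2)$-th row, for $2\le i\le m-1$, is $(\mathrm{Tr}_{q^m/q}(\alpha^i d_1),\dots,\mathrm{Tr}_{q^m/q}(\alpha^i d_n))$. Let $G_1'=[I_{m+1}:G_1]$ and let $\overline{\mathcal{C}_D}'$ be the linear code over $\mathbb{F}_q$ generated by $G_1'$. Then $\overline{\mathcal{C}_D}'$ has parameters $[n+m+1,\ m+1,\ d']$ with $d'\ge q^{r-1}(q^r-q^{r-1}-q+1)+1$, and $\overline{\mathcal{C}_D}'^{\perp}$ has parameters $[n+m+1,\ n,\ d'^{\perp}]$ with $2\le d'^{\perp}\le 3$.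
   Context: $\mathrm{Tr}_{q^k/q}$ is the trace map from $\mathbb{F}_{q^k}$ to $\mathbb{F}_q$; $I_{m+1}$ is the identity matrix of size $m+1$. The matrix $G_1$ is a generator matrix of $\{(\mathrm{Tr}_{q^m/q}(bx)+c)_{x\in D}:b\in\mathbb{F}_{q^m},c\in\mathbb{F}_q\}$. *)

(* Defs.v *)
From HB Require Import structures.
From mathcomp Require Import all_boot all_order all_algebra all_field.
Unset Printing Implicit Defensive.
Import GRing.Theory.
Local Open Scope ring_scope.

Definition fieldTr {F : fieldType} (L : fieldExtType F) (x : L) : F :=
  \tr (passmx.mxof (vbasis fullv) (vbasis fullv) (amulr x)).

(* Frobenius-sum trace Tr_{q^k/q}(y) = y + y^q + ... + y^(q^(k-1)),
   computed inside the ambient field L (used for y in F_{q^k}). *)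
Definition frobTr {R : ringType} (q k : nat) (y : R) : R :=
  \sum_(i < k) y ^+ (q ^ i).

Definition Dset {F : finFieldType} (L : fieldExtType F) (q r : nat)
  : {set finvect_type L} :=
  [set x : finvect_type L | frobTr q r (x ^+ (q ^ r).+1) == 0].

Definition G1mx {F : finFieldType} (L : fieldExtType F) (q r m : nat)
  (alpha : L) : 'M[F]_(m.+1, #|Dset L q r|) :=
  \matrix_(k < m.+1, j < #|Dset L q r|)
    if k == ord0 then 1
    else fieldTr L (alpha ^+ k.-1 * (enum_val j : L)) + (k.-1 == 1)%N%:R.

Definition G1'mx {F : finFieldType} (L : fieldExtType F) (q r m : nat)
  (alpha : L) : 'M[F]_(m.+1, m.+1 + #|Dset L q r|) :=
  row_mx 1%:M (G1mx L q r m alpha).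

Definition wt {F : fieldType} {N : nat} (u : 'rV[F]_N) : nat :=
  #|[set i : 'I_N | u 0 i != 0]|.

(* The dual code of the code generated (row space) by G: a square matrix
   whose row space is { u | u *m G^T = 0 }. *)
Definition dualmx {F : fieldType} {k N : nat} (G : 'M[F]_(k, N)) : 'M[F]_N :=
  kermx G^T.

(* Main.v *)
Require Import Defs.
From HB Require Import structures.
From mathcomp Require Import all_boot all_order all_algebra all_field.
From mathcomp Require Import zify ring.
Import GRing.Theory.
Local Open Scope ring_scope.

(**
  The form Q(x) = Tr_{q^r/q}(x^(q^r+1)) is quadratic over F_q with polar form
  B(a, x) = Tr_{q^m/q}(a^(q^r) x).  Bounding the number of roots of the
  polynomials Q and Q - c (the factor X^(q^r+1) being removed from Q), one finds
  that the bounds for c in F_q add up to q^m, so all are equalities; this gives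
  |D| and the size of every fibre of Q.  Counting in two ways the pairs
  (x, z), z in F_q, with Q(x) + z B(a, x) = 0, i.e. Q(x + z a) = z^2 Q(a), gives
  the number of points of D on the hyperplane B(a, .) = 0, and scaling gives it
  for B(a, .) = c.  No affine hyperplane contains more than q^(m-2) points of D,
  so a codeword (u, Tr(bx) + c) with b != 0 has weight at least
  1 + |D| - q^(m-2), and if b = 0 no coordinate indexed by D vanishes.
  In the dual, no column of the generator matrix is zero, and the columns at 0,
  x and l x (x in D nonzero, l in F_q different from 0 and 1) are dependent.
*)

Set Implicit Arguments.
Unset Strict Implicit.

(** * Tight bounds in sums, and fibres of polynomial maps *)

Section Counting.

(** Serves to turn upper bounds for the fibres of a map into exact sizes, once the bounds add up to
    the size of the domain. *)
Lemma eq_of_leq_sum (I : finType) (P : pred I) (f g : I -> nat) :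
  (forall i, P i -> f i <= g i)%N ->
  (\sum_(i | P i) g i <= \sum_(i | P i) f i)%N ->
  forall i, P i -> f i = g i.
Proof.
move=> le_fg le_gf i Pi.
have /leqif_sum[le_s] : forall j, P j -> (f j <= g j ?= iff (f j == g j))%N.
  by move=> j Pj; split; first exact: le_fg.
rewrite eqn_leq le_s le_gf => /esym/forallP/(_ i); rewrite Pi /= => /eqP //.
Qed.

Lemma sum_card_fibres (T U : finType) (f : T -> U) (S : {set U}) :
  (forall x, f x \in S) -> (\sum_(s in S) #|[set x | f x == s]| = #|T|)%N.
Proof.
move=> fS; rewrite -sum1_card (partition_big f (mem S)) //=.
by apply: eq_bigr => s _; rewrite sum1dep_card.
Qed.

Lemma card_fibre_poly (K : finFieldType) (p : {poly K}) (d : nat) (c : K) :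
  (0 < d)%N -> size p = d.+1 -> (#|[set x | p.[x] == c]| <= d)%N.
Proof.
move=> d0 sp; have sz : size (p - c%:P) = d.+1.
  by rewrite size_polyDl ?sp // size_polyN (leq_ltn_trans (size_polyC_leq1 c)).
rewrite cardE -ltnS -sz; apply: max_poly_roots; last exact: enum_uniq.
  by rewrite -size_poly_gt0 sz.
by apply/allP => x; rewrite mem_enum inE rootE !hornerE subr_eq0.
Qed.

Lemma size_sum_polyXn (K : fieldType) (k : nat) (f : nat -> nat) :
  (forall i, i < k -> f i < f k)%N ->
  size (\sum_(i < k.+1) 'X^(f i) : {poly K}) = (f k).+1.
Proof.
move=> fk; rewrite big_ord_recr /= addrC size_polyDl size_polyXn // ltnS.
apply: (leq_trans (size_sum _ _ _)); apply/bigmax_leqP => i _.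
by rewrite size_polyXn fk.
Qed.

End Counting.

(** * The trace as a sum of Frobenius powers *)

Section FrobeniusTrace.
Variables (K : finFieldType) (q : nat).
Hypotheses (q1 : (1 < q)%N) (qK : [pchar K].-nat q).

Lemma exprD_frob i (x y : K) : (x + y) ^+ (q ^ i) = x ^+ (q ^ i) + y ^+ (q ^ i).
Proof. by apply: exprDn_pchar; rewrite pnatX qK. Qed.

Lemma expr0_frob i : (0 : K) ^+ (q ^ i) = 0.
Proof. by rewrite expr0n expn_eq0 -leqn0 leqNgt ltnW. Qed.

Lemma frobTr0 k : frobTr q k (0 : K) = 0.
Proof. by rewrite /frobTr big1 // => i _; rewrite expr0_frob. Qed.

Lemma frobTrD k (x y : K) : frobTr q k (x + y) = frobTr q k x + frobTr q k y.
Proof. by rewrite -big_split; apply: eq_bigr => i _; rewrite exprD_frob. Qed.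

Lemma expr_fixed i (z : K) : z ^+ q = z -> z ^+ (q ^ i) = z.
Proof. by move=> zq; elim: i => // i IH; rewrite expnS exprM zq. Qed.

Lemma frobTrZ k (z x : K) :
  z ^+ q = z -> frobTr q k (z * x) = z * frobTr q k x.
Proof.
move=> zq; rewrite mulr_sumr; apply: eq_bigr => i _.
by rewrite exprMn expr_fixed.
Qed.

(** Raising to the power [q] shifts the summands cyclically: the last one becomes [y ^+ (q ^ k)],
    which is the first. *)
Lemma frobTr_fixed k (y : K) :
  y ^+ (q ^ k) = y -> frobTr q k y ^+ q = frobTr q k y.
Proof.
case: k => [_|k yk]; first by rewrite /frobTr big_ord0 expr0n; case: q q1.
rewrite /frobTr -[LHS]/((fun x => x ^+ q) _).
rewrite (big_morph _ (id1 := 0) (op1 := +%R)); last 2 first.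
- by move=> u v; have := exprD_frob 1 u v; rewrite expn1.
- by have := expr0_frob 1; rewrite expn1.
rewrite big_ord_recr big_ord_recl /= -exprM -expnSr yk addrC expn0 expr1.
by congr (_ + _); apply: eq_bigr => i _; rewrite -exprM -expnSr.
Qed.

Lemma frobTr_double k (y : K) :
  frobTr q (2 * k) y = frobTr q k (y + y ^+ (q ^ k)).
Proof.
rewrite frobTrD mul2n -addnn /frobTr big_split_ord /=; congr (_ + _).
by apply: eq_bigr => i _; rewrite expnD exprM.
Qed.

Lemma card_frobTr_fibre_le k (b c : K) :
  b != 0 -> (#|[set x | frobTr q k.+1 (b * x) == c]| <= q ^ k)%N.
Proof.
move=> b0; pose P : {poly K} := \sum_(i < k.+1) 'X^(q ^ i).
have sP : size P = (q ^ k).+1.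
  by apply: (@size_sum_polyXn K _ (fun i => q ^ i)%N) => i; rewrite ltn_exp2l.
apply: leq_trans _ (card_fibre_poly c _ sP); last by rewrite expn_gt0 ltnW.
rewrite -[leqRHS](card_preimset _ (mulfI b0)) eq_leq //; apply: eq_card => x.
rewrite !inE horner_sum; congr (_ == c).
by apply: eq_bigr => i _; rewrite hornerXn.
Qed.

End FrobeniusTrace.

(** * The elliptic quadric *)

Section Quadric.
Variables (K : finFieldType) (q s : nat) (S : {set K}).
Let r := s.+1.
Hypotheses (q1 : (1 < q)%N) (qK : [pchar K].-nat q).
Hypothesis cardK : #|K| = (q ^ (2 * r))%N.
Hypotheses (cardS : #|S| = q) (SE : forall z : K, (z \in S) = (z ^+ q == z)).

Let Q (x : K) : K := frobTr q r (x ^+ (q ^ r).+1).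
Let B (a x : K) : K := frobTr q (2 * r) (a ^+ (q ^ r) * x).

Lemma expr_card_frob (x : K) : x ^+ (q ^ (2 * r)) = x.
Proof. by rewrite -cardK expf_card. Qed.

Lemma expr_frob_twice (x : K) : (x ^+ (q ^ r)) ^+ (q ^ r) = x.
Proof. by rewrite -exprM -expnD addnn -mul2n expr_card_frob. Qed.

Lemma fixed_set0 : 0 \in S.
Proof. by rewrite SE; have := expr0_frob K q1 1; rewrite expn1 => ->. Qed.

Lemma sum_fixed_set (f : K -> nat) v : (forall z, z \in S -> z != 0 -> f z = v) ->
  (\sum_(z in S) f z = f 0%R + q.-1 * v)%N.
Proof.
move=> fv; rewrite (bigD1 0) ?fixed_set0 //= (eq_bigr (fun=> v)); last first.
  by move=> z /andP[]; apply: fv.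
rewrite sum_nat_cond_const; congr (_ + _ * _)%N.
rewrite -cardS (cardsD1 0 S) fixed_set0 /=; apply: eq_card => x.
by rewrite !inE andbC.
Qed.

(** The norm x^(q^r+1) is fixed by the q^r-th power map, because x^(q^(2r)) = x. *)
Lemma quadric_fixed x : Q x \in S.
Proof.
rewrite SE; apply/eqP/frobTr_fixed => //.
by rewrite exprS exprMn expr_frob_twice mulrC.
Qed.

Lemma polar_fixed a x : B a x \in S.
Proof. by rewrite SE; apply/eqP/frobTr_fixed => //; rewrite expr_card_frob. Qed.

(** The cross terms of (x + a)^(q^r+1) are y + y^(q^r) with y = a^(q^r) x, so [frobTr_double] merges
    their half trace into the full trace of y. *)
Lemma quadricD (x a : K) : Q (x + a) = Q x + Q a + B a x.
Proof.
rewrite /Q /B frobTr_double // -!frobTrD //; congr frobTr.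
rewrite !exprS exprMn exprD_frob // expr_frob_twice; ring.
Qed.

Lemma quadricZ (z x : K) : z \in S -> Q (z * x) = z ^+ 2 * Q x.
Proof.
rewrite SE => /eqP zq.
have zr : z ^+ (q ^ r).+1 = z ^+ 2 by rewrite exprS expr_fixed.
by rewrite /Q exprMn zr frobTrZ // -exprM mulnC exprM zq.
Qed.

Lemma polarZl (z a x : K) : z \in S -> B (z * a) x = z * B a x.
Proof.
rewrite SE => /eqP zq.
by rewrite /B exprMn -mulrA (expr_fixed _ zq) (frobTrZ _ _ zq).
Qed.

Lemma polarZr (z a x : K) : z \in S -> B a (z * x) = z * B a x.
Proof.
by rewrite SE => /eqP zq; rewrite /B [_ * (z * x)]mulrCA (frobTrZ _ _ zq).
Qed.

Let cone := #|[set x | Q x == 0]|.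

Lemma card_quadric_fibre_le c :
  (#|[set x | Q x == c]| <= (q ^ r).+1 * q ^ s)%N.
Proof.
pose P : {poly K} := \sum_(i < r) 'X^((q ^ r).+1 * q ^ i).
have sP : size P = ((q ^ r).+1 * q ^ s).+1.
  apply: (@size_sum_polyXn K _ (fun i => (q ^ r).+1 * q ^ i)%N) => i is_.
  by rewrite ltn_pmul2l // ltn_exp2l.
apply: leq_trans _ (card_fibre_poly c _ sP); last first.
  by rewrite muln_gt0 /= expn_gt0 ltnW.
rewrite eq_leq //; apply: eq_card => x; rewrite !inE horner_sum; congr (_ == c).
by apply: eq_bigr => i _; rewrite hornerXn exprM.
Qed.

(* Away from 0 the equation Q x = 0 may be divided by x ^+ (q ^ r).+1. *)
Lemma card_cone_le : (0 < s)%N -> (cone <= (q ^ r).+1 * (q ^ s).-1 + 1)%N.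
Proof.
move=> s0; pose P : {poly K} := \sum_(i < r) 'X^((q ^ r).+1 * (q ^ i).-1).
have qs i : (0 < q ^ i)%N by rewrite expn_gt0 ltnW.
have sP : size P = ((q ^ r).+1 * (q ^ s).-1).+1.
  apply: (@size_sum_polyXn K _ (fun i => (q ^ r).+1 * (q ^ i).-1)%N) => i is_.
  by rewrite ltn_pmul2l // -ltnS !prednK // ltn_exp2l.
have d0 : (0 < (q ^ r).+1 * (q ^ s).-1)%N.
  by rewrite muln_gt0 /= -ltnS prednK // -{1}(expn0 q) ltn_exp2l.
rewrite /cone addn1 (cardsD1 0) -add1n leq_add ?leq_b1 //.
apply: leq_trans _ (card_fibre_poly 0 d0 sP); apply: subset_leq_card.
apply/subsetP => x; rewrite !inE => /andP[x0 Qx].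
suff: Q x = x ^+ (q ^ r).+1 * P.[x].
  by move/eqP: Qx => -> /esym/eqP; rewrite mulf_eq0 expf_eq0 (negPf x0) andbF.
rewrite horner_sum mulr_sumr; apply: eq_bigr => i _.
by rewrite hornerXn -exprD -mulnS prednK // exprM.
Qed.

(** The bounds are tight: with u = q^s, (qu+1)(u-1) + 1 + (q-1)(qu+1)u = (qu)^2 = |K|. *)
Lemma card_quadric_fibres : (0 < s)%N ->
  (cone = (q ^ r).+1 * (q ^ s).-1 + 1)%N /\
  (forall c, c \in S -> c != 0 ->
    #|[set x | Q x == c]| = ((q ^ r).+1 * q ^ s)%N).
Proof.
move=> s0; pose g (c : K) := if c == 0 then ((q ^ r).+1 * (q ^ s).-1 + 1)%N
  else ((q ^ r).+1 * q ^ s)%N.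
have E c : c \in S -> #|[set x | Q x == c]| = g c.
  move: c; apply: (@eq_of_leq_sum _ (mem S)).
    move=> c _; rewrite /g; case: eqP => [->|_]; first exact: card_cone_le.
    exact: card_quadric_fibre_le.
  rewrite (sum_card_fibres quadric_fixed) cardK.
  rewrite (@sum_fixed_set _ ((q ^ r).+1 * q ^ s)%N) => [|c _ /negPf c0]; last first.
    by rewrite /g c0.
  rewrite /g eqxx.
  have: (0 < q ^ s)%N by rewrite expn_gt0 ltnW.
  rewrite mul2n -addnn expnD /r expnS; move: (q ^ s)%N => u.
  by clear -q1; case: u => // u _; case: q q1 => // k _ /=; lia.
split; first by rewrite /cone E ?fixed_set0 // /g eqxx.
by move=> c cS /negPf c0; rewrite E // /g c0.
Qed.

(** Each of the q fibres has at most q^(2r-1) points, by the degree of the trace polynomial, and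
    together they fill K. *)
Lemma card_polar_fibre a c : a != 0 -> c \in S ->
  #|[set x | B a x == c]| = (q ^ (2 * r).-1)%N.
Proof.
move=> a0; have b0 : a ^+ (q ^ r) != 0 by rewrite expf_eq0 negb_and a0 orbT.
have m0 : (2 * r = (2 * r).-1.+1)%N by rewrite prednK.
move: c; apply: (@eq_of_leq_sum _ (mem S)).
  by move=> c _; rewrite /B m0; apply: card_frobTr_fibre_le.
rewrite (sum_card_fibres (polar_fixed a)) cardK.
by rewrite sum_nat_const cardS -expnS -m0.
Qed.

Let section a c := #|[set x | (Q x == 0) && (B a x == c)]|.

(* Count the pairs (x, z) with Q x + z B(a, x) = 0, that is
   Q (x + z a) = z^2 Q a, first along x and then along z. *)
Lemma section0_eq a :
  (#|K| + q * section a 0%R =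
   \sum_(z in S) #|[set x | (Q x == z ^+ 2 * Q a)%R]|
     + #|[set x | (B a x == 0)%R]|)%N.
Proof.
have -> : (\sum_(z in S) #|[set x | (Q x == z ^+ 2 * Q a)%R]| =
   \sum_(z in S) #|[set x | (Q x + z * B a x == 0)%R]|)%N.
  apply: eq_bigr => z zS; rewrite -[LHS](card_preimset _ (addIr (z * a))).
  apply: eq_card => x; rewrite !inE quadricD quadricZ // polarZl //.
  by rewrite addrAC -subr_eq0 addrK.
have -> : (\sum_(z in S) #|[set x | (Q x + z * B a x == 0)%R]| =
   \sum_x #|[set z in S | (Q x + z * B a x == 0)%R]|)%N.
  under eq_bigr do rewrite -sum1dep_card.
  under [RHS]eq_bigr do rewrite -sum1dep_card.
  by rewrite (exchange_big_dep xpredT).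
rewrite -[#|K|]sum1_card -[#|[set x | B a x == 0]|]sum1dep_card.
rewrite /section -[#|[set x | (_ && _)]|]sum1dep_card big_distrr /=.
rewrite [in X in (_ + X)%N = _]big_mkcond [in X in _ = (_ + X)%N]big_mkcond /=.
rewrite -!big_split /=; apply: eq_bigr => x _; rewrite muln1.
(* For fixed x the number of z is q if B(a, x) and Q(x) both vanish, 0 if only B(a, x) does, and 1
   if B(a, x) is nonzero. *)
have [Bx|Bx] := eqVneq (B a x) 0.
  rewrite andbT Bx; have [Qx|Qx] := eqVneq (Q x) 0.
    rewrite addnC -cardS; congr addn; apply: eq_card => z.
    by rewrite inE Qx mulr0 addr0 eqxx andbT.
  rewrite (_ : [set _ in _ | _] = set0) ?cards0 //; apply/setP => z.
  by rewrite !inE mulr0 addr0 (negPf Qx) andbF.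
rewrite andbF !addn0; apply/esym/eqP/cards1P; exists (- (Q x / B a x)).
apply/setP => z; rewrite !inE.
have -> : (Q x + z * B a x == 0) = (z == - (Q x / B a x)).
  by rewrite addrC addr_eq0 -mulNr -(can2_eq (mulfK Bx) (divfK Bx)).
apply: andb_idl => /eqP ->; rewrite SE.
have /eqP Qq : Q x ^+ q == Q x by rewrite -SE quadric_fixed.
have /eqP Bq : B a x ^+ q == B a x by rewrite -SE polar_fixed.
by rewrite exprNn_pchar // exprMn exprVn Qq Bq.
Qed.

Lemma sum_sections a : (\sum_(c in S) section a c = cone)%N.
Proof.
rewrite /cone -sum1dep_card [RHS](partition_big (B a) (mem S)) /=; last first.
  by move=> x _; apply: polar_fixed.
by apply: eq_bigr => c _; rewrite sum1dep_card.
Qed.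

Lemma section_scale a c : c \in S -> c != 0 -> section a c = section a 1.
Proof.
move=> cS c0; rewrite /section -(card_preimset _ (mulfI c0)).
apply: eq_card => x; rewrite !inE quadricZ // polarZr // mulf_eq0 expf_eq0.
by rewrite (negPf c0) /= -{2}[c]mulr1 (inj_eq (mulfI c0)).
Qed.

(** With u = q^s, the sections at c = 0 and at c != 0 have u^2 - (q-1)u and u^2 points if Q(a) = 0,
    and u^2 and u^2 - u points otherwise. The first size comes from [section0_eq]; the second from
    [sum_sections], as all nonzero c give equal sections. *)
Lemma card_section_le a c : (0 < s)%N -> a != 0 -> c \in S ->
  (section a c <= q ^ s * q ^ s)%N.
Proof.
move=> s0 a0 cS; have [cone_eq fib] := card_quadric_fibres s0.
have := section0_eq a; rewrite (card_polar_fibre a0 fixed_set0) cardK.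
have := sum_sections a.
rewrite (@sum_fixed_set _ (section a 1)); last by move=> z; apply: section_scale.
have -> : section a c = if c == 0 then section a 0 else section a 1.
  by case: eqP => [->//|/eqP c0]; rewrite section_scale.
have u0 : (0 < q ^ s)%N by rewrite expn_gt0 ltnW.
have -> : (q ^ (2 * r) = q * (q * (q ^ s * q ^ s)))%N.
  by rewrite -expnD -!expnS /r; congr expn; lia.
have -> : (q ^ (2 * r).-1 = q * (q ^ s * q ^ s))%N.
  by rewrite -expnD -!expnS /r; congr expn; lia.
have [Qa|Qa] := eqVneq (Q a) 0.
  rewrite (eq_bigr (fun=> cone)); last by move=> z _; rewrite Qa mulr0.
  rewrite sum_nat_const cardS cone_eq /r expnS; move: (q ^ s)%N u0 => u.
  move=> u0 sec1 /eqP; rewrite -!mulnDr eqn_pmul2l ?(ltnW q1) // => /eqP.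
  move: (section a 0) (section a 1) u0 sec1 => n0 n1; clear -q1.
  case: u => // u; case: q q1 => // -[] // k _ _ /= sec1 sec0.
  case: ifP => _; first by lia.
  by rewrite -(leq_pmul2l (ltn0Sn k)); lia.
(* The values z^2 Q(a) need not run through all of [S], but all fibres of Q over nonzero scalars
   have the same size. *)
rewrite (@sum_fixed_set _ ((q ^ r).+1 * q ^ s)%N); last first.
  move=> z zS z0; apply: fib; last by rewrite mulf_neq0 ?expf_neq0.
  by rewrite -quadricZ // quadric_fixed.
rewrite expr0n mul0r -/cone cone_eq /r expnS; move: (q ^ s)%N u0 => u.
move: (section a 0) (section a 1) => n0 n1; clear -q1.
case: u => // u; case: q q1 => // -[] // k _ _ /= sec1 sec0.
have {}sec0 : n0 = (u.+1 * u.+1)%N.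
  by apply/eqP; rewrite -(eqn_pmul2l (ltn0Sn k.+1)); apply/eqP; lia.
case: ifP => _; first by lia.
by rewrite -(leq_pmul2l (ltn0Sn k)); lia.
Qed.

End Quadric.

(** * Finite field extensions *)

Section FiniteExtension.
Variables (F : finFieldType) (L : fieldExtType F).
Let K : finFieldType := finvect_type L.
Let q := #|F|.
Let n := \dim {: L}.

Lemma card_field_gt1 : (1 < q)%N.
Proof. exact: finNzRing_gt1. Qed.

Lemma card_finvect : #|K| = (q ^ n)%N.
Proof.
rewrite -[RHS](card_vspace (T := finvect_type L) fullv).
by apply: eq_card => x; rewrite memvf.
Qed.

Lemma pchar_nat_card : [pchar K].-nat q.
Proof.
have [p p_pr pF] := finPcharP F; rewrite /q (card_pprimeChar pF) pnatX.
by rewrite pnatE // (pchar_lalg L) pF.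
Qed.

Definition scalars : {set finvect_type L} := in_alg (finvect_type L) @: F.

Lemma card_scalars : #|scalars| = q.
Proof. by rewrite card_imset //; apply: fmorph_inj (in_alg L). Qed.

(** Over F, X^q - X is the product of the X - x; mapped to L, it has no roots outside the image of
    F. *)
Lemma mem_scalars (z : K) : (z \in scalars) = (z ^+ q == z).
Proof.
apply/imsetP/eqP => [[x _ ->]|zq].
  by rewrite -[LHS](rmorphXn (in_alg L)) /= expf_card.
have := congr1 (fun p => (map_poly (in_alg L) p).[z]) (finField_genPoly F).
rewrite rmorphB rmorphXn /= map_polyX rmorph_prod /= !hornerE.
rewrite [X in X - _](_ : _ = z) // subrr => /esym/eqP.
rewrite horner_prod => /prodf_eq0[x _].
by rewrite rmorphB /= map_polyX map_polyC !hornerE subr_eq0 => /eqP; exists x.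
Qed.

Lemma exprZ_frob i (c : F) (v : L) : (c *: v) ^+ (q ^ i) = c *: v ^+ (q ^ i).
Proof. by rewrite exprZn expr_fixed // expf_card. Qed.

Lemma expr_frob_coord i (v : L) : v ^+ (q ^ i) =
  \sum_(k < n) coord (vbasis fullv) k v *: (vbasis fullv)`_k ^+ (q ^ i).
Proof.
rewrite {1}(coord_vbasis (memvf v)).
rewrite (big_morph (fun y : L => y ^+ (q ^ i)) (id1 := 0) (op1 := +%R)).
- by apply: eq_bigr => k _; rewrite exprZ_frob.
- exact: (@exprD_frob K q pchar_nat_card).
- exact: (@expr0_frob K q card_field_gt1).
Qed.

Let moore : 'M[L]_n := \matrix_(j, i) (vbasis {: L})`_j ^+ (q ^ i).

(** A linear relation between the columns gives a combination of the X^(q^i), i < n, that vanishes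
    on a basis, hence by F-linearity on all q^n elements of L; its degree is less than q^n, so it is
    zero. *)
Lemma moore_unit : moore \in unitmx.
Proof.
rewrite -unitmx_tr -row_free_unit -kermx_eq0; apply/rowV0P => v /sub_kermxP vW.
pose P : {poly L} := \sum_(i < n) v 0 i *: 'X^(q ^ i).
have Py (y : L) : P.[y] = 0.
  rewrite horner_sum (eq_bigr (fun i : 'I_n => \sum_(k < n)
    coord (vbasis fullv) k y *: (v 0 i * (vbasis fullv)`_k ^+ (q ^ i)))).
    rewrite exchange_big big1 // => k _; rewrite -scaler_sumr.
    have /rowP/(_ k) := vW; rewrite !mxE => vWk.
    rewrite (eq_bigr (fun i => v 0 i * moore^T i k)) ?vWk ?scaler0 // => i _.
    by rewrite !mxE.
  move=> i _; rewrite hornerZ hornerXn expr_frob_coord mulr_sumr.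
  by apply: eq_bigr => k _; rewrite scalerAr.
have P0 : P = 0.
  apply/eqP; apply: contraTT isT => Pn0.
  have : (size (enum K) < size P)%N.
    apply: (@max_poly_roots K P _ Pn0); last exact: enum_uniq.
    by apply/allP => y _; rewrite rootE; apply/eqP/Py.
  rewrite -cardE card_finvect ltnNge => /negP[].
  apply: (leq_trans (size_sum _ _ _)); apply/bigmax_leqP => i _.
  apply: (leq_trans (size_scale_leq _ _)); rewrite size_polyXn.
  by rewrite ltn_exp2l ?card_field_gt1.
apply/rowP => i; rewrite mxE.
have := congr1 (fun p : {poly L} => p`_(q ^ i)) P0.
rewrite coef0 coef_sum (bigD1 i) //= coefZ coefXn eqxx mulr1 big1 ?addr0 //.
move=> j ji; rewrite coefZ coefXn eqn_exp2l ?card_field_gt1 //.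
by rewrite eq_sym (inj_eq val_inj) (negPf ji) mulr0.
Qed.

(* The matrix of multiplication by x becomes diagonal, with entries
   x ^+ (q ^ i), after conjugation by the Moore matrix of a basis. *)
Lemma fieldTr_frobTr (x : L) : (fieldTr L x)%:A = frobTr q n x.
Proof.
rewrite /fieldTr -[LHS]/(in_alg L _) -trace_map_mx.
set A := map_mx _ _; pose d : 'rV[L]_n := \row_i x ^+ (q ^ i).
have AW : A *m moore = moore *m diag_mx d.
  apply/matrixP => j i; rewrite mul_mx_diag !mxE.
  rewrite -exprMn (expr_frob_coord i); apply: eq_bigr => k _.
  rewrite !mxE /= mulr_algl; congr (_ *: _).
  by rewrite passmx.vecof_delta lfunE.
have -> : A = moore *m diag_mx d *m invmx moore.
  by rewrite -AW mulmxK // moore_unit.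
rewrite mxtrace_mulC mulmxA mulVmx ?moore_unit // mul1mx mxtrace_diag.
by apply: eq_bigr => i _; rewrite mxE.
Qed.

(** As alpha generates L as a field, its minimal polynomial over F has degree m and cannot divide a
    nonzero polynomial of smaller degree. *)
Lemma powers_generator_free m (alpha : L) (u : 'I_m -> F) :
  \dim {: L} = m ->
  (forall x : L, x != 0 -> exists k : nat, x = alpha ^+ k) ->
  \sum_(i < m) u i *: alpha ^+ i = 0 -> forall i, u i = 0.
Proof.
move=> dimL gen sum0.
have full : <<1%AS; alpha>>%VS = fullv :> {vspace L}.
  apply/eqP; rewrite eqEsubv subvf /=; apply/subvP => x _.
  have [->|/gen[k ->]] := eqVneq x 0; first exact: mem0v.
  by rewrite rpredX // memv_adjoin.
have deg : adjoin_degree 1%AS alpha = m.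
  by have := dim_Fadjoin 1%AS alpha; rewrite full dimv1 muln1 dimL.
pose P : {poly L} := \poly_(i < m) (if insub i is Some j then u j else 0)%:A.
have P0 : P = 0.
  apply/eqP; apply: contraTT isT => Pn0.
  have : minPoly 1%AS alpha %| P.
    apply: minPoly_dvdp.
      by apply/polyOver_poly => i _; apply/vlineP; eexists.
    rewrite rootE horner_poly; apply/eqP; rewrite -[RHS]sum0.
    by apply: eq_bigr => i _; rewrite valK mulr_algl.
  move/(dvdp_leq Pn0); rewrite size_minPoly deg.
  by move=> /leq_trans/(_ (size_poly _ _)); rewrite ltnn.
move=> i; have := congr1 (fun p : {poly L} => p`_i) P0.
rewrite coef0 coef_poly ltn_ord valK => /eqP.
by rewrite scaler_eq0 oner_eq0 orbF => /eqP.
Qed.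

End FiniteExtension.

(** * Linearity of the trace, verified on Frobenius sums inside L *)

Section TraceLinear.
Variables (F : finFieldType) (L : fieldExtType F).

Lemma fieldTrD (x y : L) : fieldTr L (x + y) = fieldTr L x + fieldTr L y.
Proof.
apply: (fmorph_inj (in_alg L)); rewrite /= scalerDl !fieldTr_frobTr.
exact: (frobTrD (pchar_nat_card L)).
Qed.

Lemma fieldTrZ (c : F) (x : L) : fieldTr L (c *: x) = c * fieldTr L x.
Proof.
apply: (fmorph_inj (in_alg L)); rewrite /= -scalerA !fieldTr_frobTr.
rewrite scaler_sumr; apply: eq_bigr => i _; exact: exprZ_frob.
Qed.

Lemma fieldTr0 : fieldTr L 0 = 0.
Proof. by rewrite -(scale0r 0) fieldTrZ mul0r. Qed.

Lemma fieldTr_sum (I : finType) (u : I -> F) (x : I -> L) (y : L) :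
  fieldTr L ((\sum_i u i *: x i) * y) = \sum_i u i * fieldTr L (x i * y).
Proof.
rewrite mulr_suml (big_morph _ fieldTrD fieldTr0).
by apply: eq_bigr => i _; rewrite -scalerAl fieldTrZ.
Qed.

End TraceLinear.

(** * Weights and codewords *)

Section Weight.
Variable F : fieldType.

Lemma wtE N (u : 'rV[F]_N) : wt u = (\sum_(i < N) (u 0%R i != 0%R))%N.
Proof. by rewrite /wt -sum1dep_card big_mkcond. Qed.

Lemma wt_row_mx N1 N2 (u : 'rV[F]_N1) (v : 'rV[F]_N2) :
  wt (row_mx u v) = (wt u + wt v)%N.
Proof.
rewrite !wtE big_split_ord /=; congr addn; apply: eq_bigr => i _.
  by rewrite row_mxEl.
by rewrite row_mxEr.
Qed.

Lemma wt_eq0 N (u : 'rV[F]_N) : (wt u == 0)%N = (u == 0).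
Proof.
rewrite cards_eq0; apply/eqP/eqP => [/setP u0|->].
  by apply/rowP => i; have := u0 i; rewrite !inE mxE => /negbFE/eqP.
by apply/setP => i; rewrite !inE mxE eqxx.
Qed.

Lemma wt_addn_zeros N (u : 'rV[F]_N) :
  (wt u + #|[set i | (u 0 i == 0)%R]|)%N = N.
Proof.
rewrite addnC -[RHS]card_ord -(cardsC [set i | u 0 i == 0]).
by congr addn; apply: eq_card => i; rewrite !inE.
Qed.

Lemma dual_wt_ge2 k N (G : 'M[F]_(k, N)) (c : 'rV[F]_N) :
  (forall i, exists j, G j i != 0) -> (c <= dualmx G)%MS -> c != 0 ->
  (2 <= wt c)%N.
Proof.
move=> Gcol /sub_kermxP cG; rewrite -wt_eq0 -lt0n => c0.
rewrite ltn_neqAle c0 andbT eq_sym; apply/negP => /cards1P[i /setP ci].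
have [j Gji] := Gcol i; have /rowP/(_ j) := cG; rewrite !mxE (bigD1 i) //=.
rewrite big1 ?addr0 ?mxE => [/eqP|l li]; last first.
  by have := ci l; rewrite !inE (negPf li) => /negbFE/eqP ->; rewrite mul0r.
rewrite mulf_eq0 (negPf Gji) orbF.
by have := ci i; rewrite !inE eqxx => /negPf->.
Qed.

Lemma rank_systematic k N (A : 'M[F]_(k, N)) : \rank (row_mx 1%:M A) = k.
Proof.
apply/eqP/row_freeP; exists (col_mx 1%:M 0).
by rewrite mul_row_col mulmx1 mulmx0 addr0.
Qed.

End Weight.

Section Code.
Variables (F : finFieldType) (L : fieldExtType F) (q r m : nat) (alpha : L).

(** This is the form Tr(bx) + c; the constant c collects the all-one row and the shift by 1 in the
    row of alpha. *)
Lemma G1mx_codeword (u : 'rV[F]_m.+1) j :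
  (u *m G1mx L q r m alpha) 0 j =
  fieldTr L ((\sum_(i < m) u 0 (lift ord0 i) *: alpha ^+ i) * enum_val j)
  + (u 0 0 + \sum_(i < m) u 0 (lift ord0 i) * (i == 1 :> nat)%:R).
Proof.
rewrite mxE big_ord_recl !mxE eqxx mulr1 fieldTr_sum addrCA -big_split /=.
by congr (_ + _); apply: eq_bigr => i _; rewrite !mxE -mulrDr.
Qed.

Lemma G1'mx_col_neq0 i : exists k, G1'mx L q r m alpha k i != 0.
Proof.
rewrite -[i]splitK; case: (split i) => j /=.
  by exists j; rewrite /G1'mx row_mxEl mxE eqxx oner_eq0.
by exists 0; rewrite /G1'mx row_mxEr mxE oner_eq0.
Qed.

(* 0, x and l x are affinely dependent, and the columns of G1mx depend
   affinely on the point. *)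
Lemma dual_word_wt3 (l : F) (x : L) (D0 : 0 \in Dset L q r) :
  l != 0 -> l != 1 -> x != 0 ->
  x \in Dset L q r -> l *: x \in Dset L q r ->
  exists2 c : 'rV[F]_(m.+1 + #|Dset L q r|),
     (c <= dualmx (G1'mx L q r m alpha))%MS && (c != 0) & (wt c <= 3)%N.
Proof.
move=> l0 l1 x0 Dx Dlx.
pose j1 := enum_rank_in D0 x; pose j2 := enum_rank_in D0 (l *: x).
pose j3 := enum_rank_in D0 0.
have e1 : enum_val j1 = x by rewrite enum_rankK_in.
have e2 : enum_val j2 = l *: x by rewrite enum_rankK_in.
have e3 : enum_val j3 = 0 by rewrite enum_rankK_in.
pose w : 'rV[F]_#|Dset L q r| := l *: 'e_j1 - 'e_j2 + (1 - l) *: 'e_j3.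
have j21 : j2 != j1.
  apply/eqP => /(congr1 enum_val); rewrite e1 e2 -[RHS]scale1r => /eqP.
  by rewrite -subr_eq0 -scalerBl scaler_eq0 subr_eq0 (negPf l1) (negPf x0).
have j23 : j2 != j3.
  apply/eqP => /(congr1 enum_val); rewrite e2 e3 => /eqP.
  by rewrite scaler_eq0 (negPf l0) (negPf x0).
exists (row_mx 0 w).
  apply/andP; split.
    apply/sub_kermxP; rewrite tr_row_mx mul_row_col mul0mx add0r.
    rewrite !mulmxDl mulNmx -!scalemxAl -!rowE; apply/rowP => k.
    rewrite !mxE e1 e2 e3; case: eqP => _; first by ring.
    by rewrite -scalerAr fieldTrZ mulr0 fieldTr0; ring.
  (* The coordinate at [j2] is -1, since [j2] differs from [j1] and [j3]. *)
  apply/negP => /eqP/(congr1 (fun c : 'rV_(_) => c 0 (rshift m.+1 j2))).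
  rewrite row_mxEr !mxE !eqxx (negPf j21) (negPf j23) !mulr0 addr0 add0r.
  by move/eqP; rewrite oppr_eq0 oner_eq0.
rewrite wt_row_mx (_ : wt 0 = 0%N) ?add0n; last by apply/eqP; rewrite wt_eq0.
apply: leq_trans (_ : (#|[set j1; j2; j3]| <= 3)%N).
  apply: subset_leq_card; apply/subsetP => j; rewrite !inE !mxE eqxx /=.
  apply: contraR; rewrite !negb_or -andbA => /and3P[/negPf-> /negPf-> /negPf->].
  by rewrite !mulr0 subr0 addr0.
by rewrite -setUA !cardsU1 cards1; case: (_ \notin _); case: (_ \notin _).
Qed.

End Code.

(** * The size of D and the minimum distance *)

Section MinimumDistance.
Variables (F : finFieldType) (L : fieldExtType F) (s : nat).
Hypothesis s0 : (0 < s)%N.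
Let q := #|F|.
Let r := s.+1.
Hypothesis dimL : \dim {: L} = (2 * r)%N.

Lemma card_finvect_dim : #|(finvect_type L : finFieldType)| = (q ^ (2 * r))%N.
Proof. by rewrite card_finvect dimL. Qed.

(** Expanded with s = r - 1, this is q^(r-1) (q^r - q + 1). *)
Lemma card_Dset : #|Dset L q r| = ((q ^ r).+1 * (q ^ s).-1 + 1)%N.
Proof.
have [cone _] := card_quadric_fibres (card_field_gt1 F) (pchar_nat_card L)
  card_finvect_dim (card_scalars L) (@mem_scalars F L) s0.
by rewrite -cone.
Qed.

Lemma Dset_scale (l : F) (x : finvect_type L) :
  x \in Dset L q r -> (l *: x : finvect_type L) \in Dset L q r.
Proof.
rewrite !inE -mulr_algl => /eqP Qx; apply/eqP.
have lS : (l%:A : finvect_type L) \in scalars L by apply: imset_f.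
apply: etrans (quadricZ s (@mem_scalars F L) x lS) _.
by apply/eqP; rewrite mulf_eq0; apply/orP; right; apply/eqP.
Qed.

Lemma card_Dset_hyperplane (b : L) (c : F) : b != 0 ->
  (#|[set x in Dset L q r | (fieldTr L (b * x) == c)%R]| <= q ^ s * q ^ s)%N.
Proof.
(* For a = b^(q^r) one has a^(q^r) = b, so B(a, x) is the trace of b x. *)
move=> b0; have a0 : b ^+ (q ^ r) != 0 by rewrite expf_eq0 (negPf b0) andbF.
have cS : (c%:A : finvect_type L) \in scalars L by apply: imset_f.
apply: leq_trans (card_section_le (card_field_gt1 F) (pchar_nat_card L)
  card_finvect_dim (card_scalars L) (@mem_scalars F L) s0 a0 cS).
rewrite eq_leq //; apply: eq_card => x; rewrite !inE; congr andb.
rewrite (expr_frob_twice card_finvect_dim b).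
rewrite -(inj_eq (fmorph_inj (in_alg L))) /=.
by rewrite fieldTr_frobTr dimL.
Qed.

Lemma code_wt_ge (alpha : L) (u : 'rV[F]_(2 * r).+1) :
  (2 < q)%N -> (forall x : L, x != 0 -> exists k : nat, x = alpha ^+ k) ->
  u != 0 ->
  (q ^ r.-1 * (q ^ r - q ^ r.-1 - q + 1) + 1 <=
   wt (u *m G1'mx L q r (2 * r) alpha))%N.
Proof.
move=> q2 gen u0; rewrite /G1'mx mul_mx_row mulmx1 wt_row_mx.
have wu : (0 < wt u)%N by rewrite lt0n wt_eq0.
set v := u *m _; set b := \sum_(i < 2 * r) u 0 (lift ord0 i) *: alpha ^+ i.
have nv := etrans (wt_addn_zeros v) card_Dset.
have zv : (#|[set j | (v 0 j == 0)%R]| <= q ^ s * q ^ s)%N.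
  set c := u 0 0 + \sum_(i < 2 * r) u 0 (lift ord0 i) * (i == 1 :> nat)%:R.
  have vE j : v 0 j = fieldTr L (b * enum_val j) + c by apply: G1mx_codeword.
  (* If b = 0, freeness of the powers of alpha leaves only the entry of u at 0, so the word is a
     nonzero constant on D. *)
  have [b0|b0] := eqVneq b 0.
    have ui := powers_generator_free dimL gen b0.
    have c0 : c != 0.
      apply: contraNneq u0; rewrite /c big1 ?addr0 => [u00|i _]; last first.
        by rewrite ui mul0r.
      apply/eqP/rowP => i; rewrite mxE; case: (unliftP ord0 i) => [k|] -> //.
    rewrite (_ : [set _ | _] = set0) ?cards0 //; apply/setP => j.
    by rewrite !inE vE b0 mul0r fieldTr0 add0r (negPf c0).
  apply: leq_trans (card_Dset_hyperplane (- c) b0).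
  rewrite -(card_imset _ enum_val_inj); apply: subset_leq_card.
  apply/subsetP => _ /imsetP[j jv ->]; rewrite inE enum_valP /=.
  by move: jv; rewrite inE vE addr_eq0.
have u3 : (2 < q ^ s)%N.
  by rewrite (leq_trans q2) // -[leqLHS]expn1 leq_exp2l // (ltnW q2).
move: nv zv; rewrite /r /= expnS; move: (q ^ s)%N u3 => t t3.
move: #|[set j | (v 0 j == 0)%R]| (wt v) (wt u) wu => z wv wu wu0.
move: q q2 => k k2; clear -t3 k2 wu0.
(* Here k = q and t = q^s; both exceed 2, so no subtraction is truncated. The bound then equals |D|
   - t^2 + 1. *)
have -> : (k * t - t - k + 1 = k.-1 * t.-1)%N.
  by case: k k2 t3 => // k; case: t => // t; lia.
by case: k k2 t3 => // k; case: t => // t /=; lia.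
Qed.

End MinimumDistance.

Unset Implicit Arguments.

Theorem theorem3p11
  (p e : nat) (hp : prime p)
  (F : finFieldType) (hF : #|F| = (p ^ e)%N) (hq : (2 < p ^ e)%N)
  (r : nat) (hr : (2 <= r)%N)
  (L : fieldExtType F) (hL : \dim {: L} = (2 * r)%N)
  (alpha : L) (halpha0 : alpha != 0)
  (halpha : forall x : L, x != 0 -> exists k : nat, x = alpha ^+ k) :
  let q := (p ^ e)%N in
  let m := (2 * r)%N in
  let G := G1'mx L q r m alpha in
  (* the code generated by G_1' : [n+m+1, m+1, d'] *)
  \rank G = m.+1 /\
  (forall c : 'rV[F]_(m.+1 + #|Dset L q r|), (c <= G)%MS -> c != 0 ->
     (q ^ r.-1 * (q ^ r - q ^ r.-1 - q + 1) + 1 <= wt c)%N) /\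
  (* its dual : [n+m+1, n, d'^perp] with 2 <= d'^perp <= 3 *)
  \rank (dualmx G) = #|Dset L q r| /\
  (forall c : 'rV[F]_(m.+1 + #|Dset L q r|), (c <= dualmx G)%MS -> c != 0 ->
     (2 <= wt c)%N) /\
  (exists2 c : 'rV[F]_(m.+1 + #|Dset L q r|),
     (c <= dualmx G)%MS && (c != 0) & (wt c <= 3)%N).
Proof.
move: hF hq; case: r hr hL => // s s0 dimL hF hq q m G.
have qE : q = #|F| by rewrite hF.
have rG : \rank G = m.+1 by apply: rank_systematic.
have q1 : (1 < #|F|)%N by apply: card_field_gt1.
split=> //; split.
  move=> _ /submxP[u ->] uG; have u0 : u != 0.
    by apply: contraNneq uG => ->; rewrite mul0mx.
  by rewrite /G qE; apply: code_wt_ge => //; rewrite hF.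
split; first by rewrite mxrank_ker mxrank_tr rG addKn.
split; first by move=> c; apply: dual_wt_ge2; apply: G1'mx_col_neq0.
(* Here q > 2 enters: it gives a scalar other than 0 and 1 for the word of weight at most 3. *)
have [l] : exists l, l \in ~: [set 0; 1 : F].
  apply/set0Pn; rewrite -card_gt0 cardsCs setCK subn_gt0 hF.
  by apply: leq_ltn_trans hq; rewrite cards2; case: (_ != _).
rewrite !inE negb_or => /andP[l0 l1].
have D0 : 0 \in Dset L q s.+1.
  by rewrite inE expr0n /= qE (frobTr0 _ q1).
have [x] : exists x, x \in Dset L q s.+1 :\ 0.
  apply/set0Pn; rewrite -card_gt0 -ltnS.
  have := cardsD1 0 (Dset L q s.+1); rewrite D0 add1n => <-.
  rewrite qE card_Dset // addn1 ltnS muln_gt0 /= -ltnS prednK.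
    by rewrite -{1}(expn0 #|F|) ltn_exp2l.
  by rewrite expn_gt0 ltnW.
rewrite in_setD1 => /andP[x0 Dx].
apply: (@dual_word_wt3 F L q s.+1 m alpha l x) => //.
by move: Dx; rewrite qE; apply: Dset_scale.
Qed.
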